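(* Let $(X,\mathcal B,\mu)$ be a finite measure space with $\mu(X)>0$, let $\mathcal X\subset L^0(\mu)$ be an admissible Banach space of functions defined on $X$, and let $f:X\to X$ be one-to-one, bimeasurable, nonsingular and such that the composition operator $T_f:\varphi\mapsto\varphi\circ f$ is bounded on $\mathcal X$. Then the following assertions are equivalent: (C1) $T_f$ is topologically transitive; (C2) for each $\epsilon>0$, there exist a measurable set $B$ and an integer $k\ge1$ such that $$\mu(X\setminus B)<\epsilon\quad\text{and}\quad B\cap f^k(B)=\emptyset.$$
   Context: $L^0(\mu)$ denotes the space of (classes modulo $\mu$-a.e. equality of) measurable scalar-valued functions on $X$. A Banach space of functions $(\mathcal X,\|\cdot\|)\subset L^0(\mu)$ is always assumed to be a lattice: if $\psi_1,\psi_2$ are measurable functions with $|\psi_1|\le|\psi_2|$ and $\psi_2\in\mathcal X$, then $\psi_1\in\mathcal X$ and $\|\psi_1\|\le\|\psi_2\|$. It is called admissible if: (H1) for every $A\in\mathcal B$ with finite measure, the characteristic function $\chi_A$ belongs to $\mathcal X$; (H2) the set of simple functions which vanish outside a set of finite measure is dense in $\mathcal X$; (H3) for all $\epsilon>0$ there exists $\delta>0$ such that, for all $\psi\in\mathcal X$ and all $S\in\mathcal B$, $|\psi|\ge 1$ on $S$ and $\|\psi\|\le\delta$ imply $\mu(S)<\epsilon/2$; (H4) for all $\eta>0$ and all $M>0$ there exists $\epsilon>0$ such that, for all $\psi\in\mathcal X$ and all $S\in\mathcal B$, $\mu(S)<\epsilon$, $\psi=0$ on $X\setminus S$ and $|\psi|\le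 2M$ imply $\|\psi\|<\eta/2$. A map $f:X\to X$ is bimeasurable if both preimages and images under $f$ of measurable sets are measurable. A measurable map $f$ is nonsingular if $\mu(f^{-1}(S))=0$ whenever $\mu(S)=0$. A bounded linear operator $T$ on a Banach space $\mathcal X$ is topologically transitive if for any nonempty open sets $U,V\subset\mathcal X$ there exists an integer $k\ge0$ such that $T^k(U)\cap V\ne\emptyset$. *)

(* Defs.v *)
From HB Require Import structures.
From mathcomp Require Import all_boot all_order all_algebra.
From mathcomp Require Import complex.
From mathcomp Require Import all_classical all_reals all_analysis.
From mathcomp Require Import measurable_realfun.

Set Implicit Arguments.
Unset Strict Implicit.
Unset Printing Implicit Defensive.

Import Order.TTheory GRing.Theory Num.Theory.
Import numFieldNormedType.Exports.

Local Open Scope classical_set_scope.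
Local Open Scope ring_scope.

Inductive scalar_kind := RealScalars | ComplexScalars.

(* The order of [R[i]] is the partial one ([x <= y] iff [y - x] is a
   nonnegative real) and norms take their values in the scalar field itself.
   So [`|x| <= `|y|] is the usual comparison of moduli, and [0 < delta], for a
   scalar [delta], says that [delta] is a positive real number. *)
Definition scalar (R : realType) (c : scalar_kind) : numFieldType :=
  match c with
  | RealScalars => R : numFieldType
  | ComplexScalars => R[i] : numFieldType
  end.

Section Scalar_measurability.
Context (R : realType) (c : scalar_kind) d (T : measurableType d).
Local Notation K := (scalar R c).

Definition scalar_measurable : (T -> K) -> Prop :=
  match c return (T -> scalar R c) -> Prop with
  | RealScalars => fun phi : T -> R => measurable_fun setT phi
  | ComplexScalars => fun phi : T -> R[i] =>
      measurable_fun setT (fun x => complex.Re (phi x)) /\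
      measurable_fun setT (fun x => complex.Im (phi x))
  end.

Definition smfun_pred : {pred T -> K} := fun phi => `[< scalar_measurable phi >].

Lemma smfun_submod_closed : submod_closed smfun_pred.
Proof.
rewrite /smfun_pred /scalar_measurable; case: c => /=; split.
- exact/asboolP/measurable_cst.
- move=> a phi psi /asboolP mphi /asboolP mpsi; apply/asboolP.
  by apply: measurable_funD => //; exact: measurable_funM.
- by apply/asboolP; split; exact: measurable_cst.
- move=> [a b] phi psi /asboolP[mphi1 mphi2] /asboolP[mpsi1 mpsi2].
  apply/asboolP; split.
  + rewrite (_ : (fun x => _) = (fun x =>
      (a * complex.Re (phi x) - b * complex.Im (phi x)) + complex.Re (psi x))).
      apply: measurable_funD => //.
      by apply: measurable_funB; exact: measurable_funM.
    by apply/funext => x /=; rewrite !fctE; case: (phi x) (psi x) => [? ?] [].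
  + rewrite (_ : (fun x => _) = (fun x =>
      (a * complex.Im (phi x) + b * complex.Re (phi x)) + complex.Im (psi x))).
      apply: measurable_funD => //.
      by apply: measurable_funD; exact: measurable_funM.
    by apply/funext => x /=; rewrite !fctE; case: (phi x) (psi x) => [? ?] [].
Qed.

HB.instance Definition _ :=
  GRing.isSubmodClosed.Build K (T -> K) smfun_pred smfun_submod_closed.

Record smfun := Smfun {
  smfun_val :> T -> K;
  _ : smfun_val \in smfun_pred }.

HB.instance Definition _ := [isSub for smfun_val].
HB.instance Definition _ := [Choice of smfun by <:].
HB.instance Definition _ := [SubChoice_isSubLmodule of smfun by <:].

End Scalar_measurability.

Arguments smfun R c {d} T.

Section L0_space.
Context (R : realType) (c : scalar_kind) d (T : measurableType d).
Variable mu : {measure set T -> \bar R}.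
Local Notation K := (scalar R c).
Local Open Scope quotient_scope.

Definition smfun_ae_eq (phi psi : smfun R c T) : bool :=
  `[< \forall x \ae mu, phi x = psi x >].

Lemma smfun_ae_eq_refl : reflexive smfun_ae_eq.
Proof. by move=> phi; apply/asboolP; exact: aeW. Qed.

Lemma smfun_ae_eq_sym : symmetric smfun_ae_eq.
Proof.
by move=> phi psi; apply/asboolP/asboolP; apply: filterS => x ->.
Qed.

Lemma smfun_ae_eq_trans : transitive smfun_ae_eq.
Proof.
move=> psi phi chi /asboolP h1 /asboolP h2; apply/asboolP.
by apply: filterS2 h1 h2 => x -> ->.
Qed.

Canonical smfun_ae_eq_equiv :=
  EquivRel smfun_ae_eq smfun_ae_eq_refl smfun_ae_eq_sym smfun_ae_eq_trans.

Definition L0 : Type := {eq_quot smfun_ae_eq}.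
HB.instance Definition _ := Choice.on L0.
HB.instance Definition _ := EqQuotient.on L0.

Implicit Types (u v w : L0) (phi psi : smfun R c T).

Lemma L0_eqP phi psi :
  (\forall x \ae mu, phi x = psi x) <-> \pi_L0 phi = \pi_L0 psi.
Proof.
by split=> [h|/eqmodP/asboolP//]; apply/eqmodP/asboolP.
Qed.

Definition L0_add u v : L0 := \pi_L0 (repr u + repr v).
Definition L0_opp u : L0 := \pi_L0 (- repr u).
Definition L0_zero : L0 := \pi_L0 0.
Definition L0_scale (a : K) u : L0 := \pi_L0 (a *: repr u).

Lemma repr_L0 phi : \forall x \ae mu, (repr (\pi_L0 phi) : smfun R c T) x = phi x.
Proof. by apply/L0_eqP; rewrite reprK. Qed.

Lemma L0_addE phi psi : L0_add (\pi phi) (\pi psi) = \pi_L0 (phi + psi).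
Proof.
apply/L0_eqP; apply: filterS2 (repr_L0 phi) (repr_L0 psi) => x h1 h2.
by change (smfun_val (repr (\pi_L0 phi)) x + smfun_val (repr (\pi_L0 psi)) x
  = phi x + psi x); rewrite h1 h2.
Qed.

Lemma L0_oppE phi : L0_opp (\pi phi) = \pi_L0 (- phi).
Proof.
apply/L0_eqP; apply: filterS (repr_L0 phi) => x h.
by change (- smfun_val (repr (\pi_L0 phi)) x = - phi x); rewrite h.
Qed.

Lemma L0_scaleE a phi : L0_scale a (\pi phi) = \pi_L0 (a *: phi).
Proof.
apply/L0_eqP; apply: filterS (repr_L0 phi) => x h.
by change (a * smfun_val (repr (\pi_L0 phi)) x = a * phi x); rewrite h.
Qed.

Lemma L0_addA : associative L0_add.
Proof.
by elim/quotW => u; elim/quotW => v; elim/quotW => w; rewrite !L0_addE addrA.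
Qed.

Lemma L0_addC : commutative L0_add.
Proof. by elim/quotW => u; elim/quotW => v; rewrite !L0_addE addrC. Qed.

Lemma L0_add0 : left_id L0_zero L0_add.
Proof. by elim/quotW => u; rewrite L0_addE add0r. Qed.

Lemma L0_addN : left_inverse L0_zero L0_opp L0_add.
Proof. by elim/quotW => u; rewrite L0_oppE L0_addE addNr. Qed.

HB.instance Definition _ :=
  GRing.isZmodule.Build L0 L0_addA L0_addC L0_add0 L0_addN.

Lemma L0_scaleA a b u : L0_scale a (L0_scale b u) = L0_scale (a * b) u.
Proof. by elim/quotW: u => u; rewrite !L0_scaleE scalerA. Qed.

Lemma L0_scale1 : left_id 1 L0_scale.
Proof. by elim/quotW => u; rewrite L0_scaleE scale1r. Qed.

Lemma L0_scaleDr : right_distributive L0_scale +%R.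
Proof.
move=> a; elim/quotW => u; elim/quotW => v.
change (L0_scale a (L0_add (\pi u) (\pi v))
  = L0_add (L0_scale a (\pi u)) (L0_scale a (\pi v))).
by rewrite L0_addE !L0_scaleE L0_addE scalerDr.
Qed.

Lemma L0_scaleDl u : {morph L0_scale^~ u : a b / a + b}.
Proof.
elim/quotW: u => u a b /=.
change (L0_scale (a + b) (\pi u)
  = L0_add (L0_scale a (\pi u)) (L0_scale b (\pi u))).
by rewrite !L0_scaleE L0_addE scalerDl.
Qed.

HB.instance Definition _ := GRing.Zmodule_isLmodule.Build K L0
  L0_scaleA L0_scale1 L0_scaleDr L0_scaleDl.

Definition L0_version (u : L0) (phi : T -> K) : Prop :=
  exists2 g : smfun R c T, g = phi :> (T -> K) & u = \pi_L0 g.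

End L0_space.

Arguments L0 {R} c {d T} mu.

Section Function_spaces.
Context (R : realType) (c : scalar_kind) d (T : measurableType d).
Variable mu : {measure set T -> \bar R}.
Local Notation K := (scalar R c).

(* The inclusion of the space in [L0 c mu] is the injective linear map
   [bfs_incl]. *)
Record banach_function_space := BanachFunctionSpace {
  bfs_space :> completeNormedModType K;
  bfs_incl : {linear bfs_space -> L0 c mu};
  bfs_incl_inj : injective bfs_incl;
  bfs_lattice : forall (psi1 psi2 : T -> K) (v2 : bfs_space),
    scalar_measurable psi1 -> L0_version (bfs_incl v2) psi2 ->
    (\forall x \ae mu, `|psi1 x| <= `|psi2 x|) ->
    exists2 v1 : bfs_space, L0_version (bfs_incl v1) psi1 & `|v1| <= `|v2| }.

Definition version {E : banach_function_space} (v : E) (psi : T -> K) : Prop :=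
  L0_version (bfs_incl E v) psi.

Definition simple_finite_support (psi : T -> K) : Prop :=
  [/\ scalar_measurable psi, finite_set (range psi) &
      exists A : set T, [/\ measurable A, (mu A < +oo)%E &
        forall x, ~ A x -> psi x = 0]].

Record admissible (E : banach_function_space) : Prop := Admissible {
  admissible_H1 : forall A : set T, measurable A -> (mu A < +oo)%E ->
    exists v : E, version v (\1_A : T -> K);
  admissible_H2 :
    dense [set v : E | exists2 psi, simple_finite_support psi & version v psi];
  admissible_H3 : forall eps : R, 0 < eps -> exists2 delta : K, 0 < delta &
    forall (v : E) (psi : T -> K) (S : set T), version v psi -> measurable S ->
      (forall x, S x -> 1 <= `|psi x|) -> `|v| <= delta ->
      (mu S < (eps / 2)%:E)%E;
  admissible_H4 : forall eta M : K, 0 < eta -> 0 < M ->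
    exists2 eps : R, 0 < eps &
    forall (v : E) (psi : T -> K) (S : set T), version v psi -> measurable S ->
      (mu S < eps%:E)%E -> (forall x, ~ S x -> psi x = 0) ->
      (forall x, `|psi x| <= 2 * M) -> `|v| < eta / 2 }.

(* Since [bfs_incl] is injective, at most one map [Tf] satisfies this, and one
   exists iff composition with [f] is well defined on classes of [E] and maps
   [E] into itself; such a [Tf] is automatically linear. *)
Definition composition_operator {E : banach_function_space} (f : T -> T)
    (Tf : E -> E) : Prop :=
  forall (v : E) (phi : T -> K), version v phi -> version (Tf v) (phi \o f).

Definition bounded_operator {E : banach_function_space} (A : E -> E) : Prop :=
  exists C : K, forall v : E, `|A v| <= C * `|v|.

Definition bimeasurable (f : T -> T) : Prop :=
  measurable_fun setT f /\
  forall A : set T, measurable A -> measurable (f @` A).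

Definition nonsingular (f : T -> T) : Prop :=
  forall S : set T, measurable S -> mu S = 0%E -> mu (f @^-1` S) = 0%E.

End Function_spaces.

Arguments banach_function_space {R} c {d T} mu.

Definition topologically_transitive {V : topologicalType} (A : V -> V) : Prop :=
  forall U W : set V, open U -> open W -> U !=set0 -> W !=set0 ->
    exists k : nat, (iter k A @` U) `&` W !=set0.

(* Main.v *)
(** If [T_f] is transitive, some [w] close to the constant [1] has [w o f^k]
    close to [-1]; by (H3), outside a set of small measure [Re w > 0] and
    [Re (w o f^k) < 0], so the remaining set [B] is disjoint from [f^k(B)].
    Conversely, given simple functions [u] and [v], let [w] be [v o f^-k] on
    [f^k(B)] and [u] elsewhere.  Then [w - u] vanishes off [f^k(B)], which lies
    in the complement of [B], and [w o f^k - v] vanishes on [B]; both are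
    bounded, so (H4) makes their norms small. *)

Require Import Defs.
From mathcomp Require Import all_boot all_order all_algebra.
From mathcomp Require Import all_classical all_reals all_analysis.
From mathcomp Require Import complex measurable_realfun.

Import Order.TTheory GRing.Theory Num.Theory.
Import numFieldNormedType.Exports.

Local Open Scope classical_set_scope.
Local Open Scope ring_scope.

Section versions.
Context {R : realType} {c : scalar_kind} {d : measure_display}
  {X : measurableType d} {mu : {measure set X -> \bar R}}
  {E : banach_function_space c mu}.
Local Notation K := (Defs.scalar R c).

Lemma version_measurable (v : E) (phi : X -> K) :
  version v phi -> scalar_measurable phi.
Proof. by case=> -[g mg] /= <- _; exact/asboolP. Qed.

Lemma versionD (v w : E) (phi psi : X -> K) :
  version v phi -> version w psi -> version (v + w) (fun x => phi x + psi x).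
Proof.
move=> [g <- vg] [h <- wh]; exists (g + h) => //.
(* The sum in the quotient is displayed as [L0_add], the form on which [L0_addE] computes with
   classes. *)
have -> : bfs_incl E (v + w) = L0_add (bfs_incl E v) (bfs_incl E w).
  exact: raddfD.
by rewrite vg wh L0_addE.
Qed.

Lemma versionZ (a : K) (v : E) (phi : X -> K) :
  version v phi -> version (a *: v) (fun x => a * phi x).
Proof.
move=> [g <- vg]; exists (a *: g) => //.
have -> : bfs_incl E (a *: v) = L0_scale a (bfs_incl E v) by exact: linearZ.
by rewrite vg L0_scaleE.
Qed.

Lemma versionB (v w : E) (phi psi : X -> K) :
  version v phi -> version w psi -> version (v - w) (fun x => phi x - psi x).
Proof.
move=> vphi /(versionZ (-1)) wpsi.
have := versionD _ _ _ _ vphi wpsi.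
by rewrite scaleN1r; congr version; apply/funext => x; rewrite mulN1r.
Qed.

Lemma version_iter (f : X -> X) (Tf : E -> E) (k : nat) (v : E) (phi : X -> K) :
  composition_operator f Tf -> version v phi ->
  version (iter k Tf v) (phi \o iter k f).
Proof.
move=> Tf_comp vphi; elim: k => [//|k IH].
by have := Tf_comp _ _ IH; congr version; apply/funext => x /=; rewrite -iterSr.
Qed.

End versions.

(** Lets one argument serve both scalar fields: the sign of the real part separates values near 1
    from values near -1. *)
Definition scalar_re {R : realType} {c : scalar_kind} : Defs.scalar R c -> R :=
  match c with
  | RealScalars => fun z : R => z
  | ComplexScalars => fun z : R[i] => complex.Re z
  end.

Lemma measurable_scalar_re (R : realType) (c : scalar_kind)
    (d : measure_display) (X : measurableType d) (phi : X -> Defs.scalar R c) :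
  scalar_measurable phi -> measurable_fun setT (scalar_re \o phi).
Proof. by case: c phi => [|] phi //= []. Qed.

(** The modulus of [z - 1] dominates that of its real part, which is at most -1. This supplies the
    threshold 1 demanded by (H3). *)
Lemma scalar_re_le0 (R : realType) (c : scalar_kind) (z : Defs.scalar R c) :
  scalar_re z <= 0 -> 1 <= `|z - 1|.
Proof.
case: c z => /= [z z0|[a b] /= a0].
  by rewrite ler0_norm ?subr_le0 ?(le_trans z0)// opprB lerBrDl gerDr.
apply: le_trans (normc_ge_Re _); rewrite /= lecR.
by rewrite ler0_norm ?subr_le0 ?(le_trans a0)// opprB lerBrDl gerDr.
Qed.

Lemma scalar_reN (R : realType) (c : scalar_kind) (z : Defs.scalar R c) :
  scalar_re (- z) = - scalar_re z.
Proof. by case: c z => //= -[]. Qed.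

Lemma measurable_glue {d d' : measure_display} {X : measurableType d}
    {Y : measurableType d'} (F : X -> X) (B : set X) (u v w : X -> Y) :
  (forall A, measurable A -> measurable (F @` A)) -> measurable B ->
  measurable_fun setT u -> measurable_fun setT v ->
  (forall y, B y -> w (F y) = v y) ->
  (forall x, ~ (F @` B) x -> w x = u x) ->
  measurable_fun setT w.
Proof.
move=> mF mB mu mv wv wu _ Z mZ; rewrite setTI.
have -> : w @^-1` Z = F @` (B `&` v @^-1` Z) `|` (~` (F @` B) `&` u @^-1` Z).
  apply/seteqP; split=> [x /= Zx|x /= [[y [By Zy] <-]|[nx Zx]]].
  - have [[y By yx]|nx] := pselect ((F @` B) x); last by right; rewrite -wu.
    by left; exists y => //; split => //=; rewrite -wv// yx.
  - by rewrite wv.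
  - by rewrite wu.
have mU : measurable (u @^-1` Z) by rewrite -[_ @^-1` _]setTI; exact: mu.
have mV : measurable (v @^-1` Z) by rewrite -[_ @^-1` _]setTI; exact: mv.
apply: measurableU; first by apply: mF; exact: measurableI.
by apply: measurableI => //; apply: measurableC; exact: mF.
Qed.

Lemma scalar_measurable_glue {R : realType} {c : scalar_kind}
    {d : measure_display} {X : measurableType d}
    (F : X -> X) (B : set X) (u v w : X -> Defs.scalar R c) :
  (forall A, measurable A -> measurable (F @` A)) -> measurable B ->
  scalar_measurable u -> scalar_measurable v ->
  (forall y, B y -> w (F y) = v y) ->
  (forall x, ~ (F @` B) x -> w x = u x) ->
  scalar_measurable w.
Proof.
move=> mF mB; case: c u v w => /= u v w.
  by move=> mu mv wv wu; exact: (measurable_glue F B u v).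
move=> [mu1 mu2] [mv1 mv2] wv wu; split.
  by apply: (measurable_glue F B _ _ _ mF mB mu1 mv1) => x hx; rewrite ?wv ?wu.
by apply: (measurable_glue F B _ _ _ mF mB mu2 mv2) => x hx; rewrite ?wv ?wu.
Qed.

Lemma exists_glue {X Y : Type} (F : X -> X) (B : set X) (u v : X -> Y) :
  injective F -> exists w : X -> Y,
    (forall y, B y -> w (F y) = v y) /\
    (forall x, ~ (F @` B) x -> w x = u x).
Proof.
move=> F_inj.
have /choice[w ww] : forall x, exists a : Y,
    (forall y, B y -> F y = x -> a = v y) /\ (~ (F @` B) x -> a = u x).
  move=> x; have [[y By yx]|nx] := pselect ((F @` B) x).
    exists (v y); split=> [z Bz|[]]; last by exists y.
    by rewrite -yx => /F_inj ->.
  by exists (u x); split=> // y By yx; case: nx; exists y.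
by exists w; split=> x hx; [apply: (ww _).1|exact: (ww _).2].
Qed.

Lemma finite_range_bounded {K : numFieldType} {X : Type} (phi : X -> K) :
  finite_set (range phi) -> exists2 M : K, 0 < M & forall x, `|phi x| <= M.
Proof.
(* The sum bounds every modulus without any comparison between them; the added 1 makes the bound
   positive, as (H4) requires. *)
move=> /finite_seqP[s rs]; exists (1 + \sum_(z <- s) `|z|).
  by rewrite ltr_pwDl// sumr_ge0.
move=> x; have xs : phi x \in s.
  have : range phi (phi x) by exists x.
  by rewrite rs.
by rewrite (big_rem _ xs) /= addrCA lerDl addr_ge0// sumr_ge0.
Qed.

(** With (H2), this reduces transitivity to balls centred at classes of simple functions. *)
Lemma dense_open_ball {K : numFieldType} {V : normedModType K} {D U : set V} :
  dense D -> open U -> U !=set0 ->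
  exists2 u, D u & exists2 e : K, 0 < e & forall w, `|w - u| < e -> U w.
Proof.
move=> dD oU U0; have [u [Uu Du]] := dD _ U0 oU.
exists u => //; have /nbhs_ballP[e /= e0 eU] := open_nbhs_nbhs (conj oU Uu).
by exists e => // w wu; apply: eU; rewrite -ball_normE /= distrC.
Qed.

Theorem corollary1p3 (R : realType) (c : scalar_kind)
    (d : measure_display) (X : measurableType d)
    (mu : {finite_measure set X -> \bar R})
    (mu_gt0 : (0 < mu setT)%E)
    (E : banach_function_space c mu) (admE : admissible E)
    (f : X -> X) (f_inj : injective f) (f_bimeas : bimeasurable f)
    (f_nonsing : nonsingular mu f)
    (Tf : E -> E) (Tf_comp : composition_operator f Tf)
    (Tf_bounded : bounded_operator Tf) :
  topologically_transitive Tf <->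
  (forall eps : R, 0 < eps ->
     exists (B : set X) (k : nat),
       [/\ measurable B, (1 <= k)%N, (mu (~` B) < eps%:E)%E &
           B `&` (iter k f @` B) = set0]).
Proof.
have muT : (mu setT < +oo)%E by rewrite ltey_eq fin_num_measure.
have [one one1] := admissible_H1 admE measurableT muT.
rewrite indicT in one1; split=> [transT eps0 eps0_gt0|C2 U V oU oV U0 V0].
- (* Taking [eps <= mu X] excludes [k = 0], for which [B] would be empty. *)
  pose eps := Num.min eps0 (fine (mu setT)).
  have eps_gt0 : 0 < eps.
    by rewrite lt_min eps0_gt0 fine_gt0// mu_gt0 muT.
  have [delta delta_gt0 H3] := admissible_H3 admE eps_gt0.
  have [k [_ [[v v1 <-] Tv1]]] := transT (ball one delta) (ball (- one) delta)
    (ball_open _ _) (ball_open _ _)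
    (ex_intro _ _ (ballxx _ delta_gt0)) (ex_intro _ _ (ballxx _ delta_gt0)).
  (* One representative [v'] is fixed, and [v' \o iter k f] represents the iterate. Both exceptional
     sets then come from the same function, so the disjointness holds exactly and not merely up to a
     null set. *)
  have [v' vv'] : exists v', version v v'.
    by rewrite /version; elim/quotW: (bfs_incl E v) => g; exists g, g.
  have Tvv' := version_iter _ _ k _ _ Tf_comp vv'.
  pose S1 := [set x | scalar_re (v' x) <= 0].
  pose S2 := [set x | 0 <= scalar_re (v' (iter k f x))].
  have mS1 : measurable S1.
    have := measurable_scalar_re _ _ _ _ _ (version_measurable _ _ vv').
    move=> /(_ measurableT _ (measurable_itv `]-oo, 0])).
    by rewrite setTI; congr measurable; apply/seteqP; split=> x /=;
      rewrite in_itv.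
  have mS2 : measurable S2.
    have := measurable_scalar_re _ _ _ _ _ (version_measurable _ _ Tvv').
    move=> /(_ measurableT _ (measurable_itv `[0, +oo[)).
    by rewrite setTI; congr measurable; apply/seteqP; split=> x /=;
      rewrite in_itv /= andbT.
  have muS1 : (mu S1 < (eps / 2)%:E)%E.
    apply: (H3 (v - one) _ _ (versionB _ _ _ _ vv' one1)) => //.
      by move=> x S1x; exact: scalar_re_le0.
    by move: v1; rewrite -ball_normE /= distrC => /ltW.
  have muS2 : (mu S2 < (eps / 2)%:E)%E.
    (* The sign change turns closeness to -1 into closeness to 1, so [scalar_re_le0] applies on [S2]
       as well. *)
    apply: (H3 (- iter k Tf v - one) (fun x => -1 * v' (iter k f x) - 1)) => //.
    + have := versionB _ _ _ _ (versionZ (-1) _ _ Tvv') one1.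
      by rewrite scaleN1r.
    + move=> x S2x; apply: scalar_re_le0.
      by rewrite mulN1r scalar_reN oppr_le0.
    + by move: Tv1; rewrite -ball_normE /= addrC => /ltW.
  have mS : measurable (S1 `|` S2) by exact: measurableU.
  have muS : (mu (S1 `|` S2) < eps%:E)%E.
    rewrite (le_lt_trans (measureU2 mu mS1 mS2))// [eps]splitr EFinD.
    exact: lteD.
  (* If [y] is the image of [x] under [iter k f] and [x] is not in [S2], then [v'] has negative real
     part at [y], which puts [y] in [S1]. *)
  have B0 : ~` (S1 `|` S2) `&` (iter k f @` (~` (S1 `|` S2))) = set0.
    apply/seteqP; split=> // y [nS [x nSx fx]]; apply: nSx; right.
    rewrite /S2 /= fx leNgt; apply/negP => re0; apply: nS; left.
    by rewrite /S1 /= ltW.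
  exists (~` (S1 `|` S2)), k; split=> //.
  + exact: measurableC.
  + rewrite lt0n; apply/eqP => k0; move: B0; rewrite k0 /= image_id setIid.
    move=> /(congr1 setC); rewrite setCK setC0 => ST.
    move: muS; rewrite ST ltNge => /negP; apply.
    by rewrite -[leRHS]fineK ?fin_num_measure// lee_fin ge_min lexx orbT.
  + by rewrite setCK (lt_le_trans muS)// lee_fin ge_min lexx.
- have dE := admissible_H2 admE.
  have [u [u' [mu' /finite_range_bounded[Mu Mu0 uM] _] uu'] [e e0 eU]] :=
    dense_open_ball dE oU U0.
  have [v [v' [mv' /finite_range_bounded[Mv Mv0 vM] _] vv'] [r r0 rV]] :=
    dense_open_ball dE oV V0.
  (* A common bound for [u'] and [v'] also bounds the glued function, so differences stay below the
     [2 * M] of (H4). *)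
  pose M := Mu + Mv; have M0 : 0 < M by exact: addr_gt0.
  have {}uM x : `|u' x| <= M by rewrite (le_trans (uM x))// lerDl ltW.
  have {}vM x : `|v' x| <= M by rewrite (le_trans (vM x))// lerDr ltW.
  have [e1 e1_gt0 He] := admissible_H4 admE e0 M0.
  have [r1 r1_gt0 Hr] := admissible_H4 admE r0 M0.
  (* The minimum lets a single [B] serve both uses of (H4), near [u] and near [v]. *)
  have [|B [k [mB _ muB Bk]]] := C2 (Num.min e1 r1).
    by rewrite lt_min e1_gt0.
  have F_inj : injective (iter k f) by elim: k {muB Bk} => [//|k IH] x y /= /f_inj /IH.
  have mF A : measurable A -> measurable (iter k f @` A).
    elim: k {muB Bk F_inj} A => [|k IH] A mA; first by rewrite /= image_id.
    have -> : iter k.+1 f @` A = f @` (iter k f @` A) by rewrite -image_comp.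
    by apply: f_bimeas.2; exact: IH.
  have [w' [wv wu]] := exists_glue _ B u' v' F_inj.
  have mw' := scalar_measurable_glue _ _ _ _ _ mF mB mu' mv' wv wu.
  have wM x : `|w' x| <= M.
    have [[y By <-]|nx] := pselect ((iter k f @` B) x); first by rewrite wv.
    by rewrite wu.
  (* The glued function is dominated by the constant [M], which lies in the space by (H1), so the
     lattice property puts it there too. *)
  have [w ww' _] : exists2 w : E, version w w' & `|w| <= `|M *: one|.
    apply: bfs_lattice mw' (versionZ M _ _ one1) _.
    by apply: aeW => x /=; rewrite mulr1 (gtr0_norm M0).
  have bound2 (a b : Defs.scalar R c) :
      `|a| <= M -> `|b| <= M -> `|a - b| <= 2 * M.
    move=> aM bM; rewrite (le_trans (ler_normB _ _))// mulr2n mulrDl mul1r.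
    exact: lerD.
  have half (t : Defs.scalar R c) : 0 < t -> t / 2 < t.
    by move=> t0; rewrite ltr_pdivrMr// ltr_pMr// ltr1n.
  exists k, (iter k Tf w); split.
  + exists w => //; apply: eU; apply: lt_trans (half _ e0).
    apply: (He _ _ (iter k f @` B) (versionB _ _ _ _ ww' uu')).
    * exact: mF.
    * apply: (@le_lt_trans _ _ (mu (~` B))).
        apply: le_measure; rewrite ?inE; [exact: mF|exact: measurableC|].
        by move=> x Fx Bx; have : set0 x by rewrite -Bk; split.
      by rewrite (lt_le_trans muB)// lee_fin ge_min lexx.
    * by move=> x nx; rewrite wu// subrr.
    * by move=> x; exact: bound2 (wM _) (uM _).
  + apply: rV; apply: lt_trans (half _ r0).
    apply: (Hr _ _ (~` B)
      (versionB _ _ _ _ (version_iter _ _ k _ _ Tf_comp ww') vv')).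
    * exact: measurableC.
    * by rewrite (lt_le_trans muB)// lee_fin ge_min lexx orbT.
    * by move=> x nnB /=; rewrite wv ?subrr//; exact: contrapT nnB.
    * by move=> x; exact: bound2 (wM _) (vM _).
Qed.
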